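(* For every acute triangle $ABC$ with $a<b$ and $a<c$, letting $d(X)$ denote the signed distance from a point $X$ to line $BC$, we have $$d(X_{26})>d(X_{20})>d(X_{22})>d(X_{40})>d(X_{8})>d(X_9)>d(X_{10})>d(X_2)>d(X_{37})>d(X_1)>d(X_7)>d(X_{29})$$ $$>d(X_{33})>d(X_4)>d(X_{27})>d(X_{19})>d(X_{28})>d(X_{25})>d(X_{34})>d(X_{24})>d(X_{36})>d(X_{16}).$$ Equivalently, in the side order, $X_{26}\prec X_{20}\prec X_{22}\prec X_{40}\prec X_8\prec X_9\prec X_{10}\prec X_2\prec X_{37}\prec X_1\prec X_7\prec X_{29}\prec X_{33}\prec X_4\prec X_{27}\prec X_{19}\prec X_{28}\prec X_{25}\prec X_{34}\prec X_{24}\prec X_{36}\prec X_{16}$.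
   Context: $X_n$ denotes the $n$-th triangle center listed in Kimberling's Encyclopedia of Triangle Centers (ETC), given by barycentric coordinates in terms of $a=BC$, $b=CA$, $c=AB$. The signed distance $d(P)$ from a point $P$ to side $BC$ is the (Euclidean) distance from $P$ to line $BC$, taken positive if $P$ lies on the same side of $BC$ as $A$ and negative if on the opposite side. The side order is defined by: $P\prec Q$ if $d(P)>d(Q)$ in every acute triangle $ABC$ with smallest side $BC$ ($a<b$, $a<c$). *)

(* Defs.v *)
From Stdlib Require Import Reals.
Open Scope R_scope.

Definition point : Type := (R * R)%type.

Definition pdist (P Q : point) : R :=
  sqrt ((fst P - fst Q) ^ 2 + (snd P - snd Q) ^ 2).

Definition cross (O P Q : point) : R :=
  (fst P - fst O) * (snd Q - snd O) - (snd P - snd O) * (fst Q - fst O).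

Definition dot (O P Q : point) : R :=
  (fst P - fst O) * (fst Q - fst O) + (snd P - snd O) * (snd Q - snd O).

Definition acute_triangle (A B C : point) : Prop :=
  cross A B C <> 0 /\ 0 < dot A B C /\ 0 < dot B C A /\ 0 < dot C A B.

Definition side_a (A B C : point) : R := pdist B C.
Definition side_b (A B C : point) : R := pdist C A.
Definition side_c (A B C : point) : R := pdist A B.

(** Signed distance from P to line BC: the Euclidean distance
    |cross B C P| / |BC|, positive iff P is on the same side of BC as A. *)
Definition signed_dist_BC (A B C P : point) : R :=
  cross B C P * cross B C A / (Rabs (cross B C A) * pdist B C).

(** * Triangle centers via barycentric coordinates.
    A center is given by its first barycentric coordinate f(a,b,c);
    the barycentrics are f(a,b,c) : f(b,c,a) : f(c,a,b). *)
Definition center : Type := R -> R -> R -> R.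

Definition center_point (f : center) (A B C : point) : point :=
  let a := side_a A B C in let b := side_b A B C in let c := side_c A B C in
  let u := f a b c in let v := f b c a in let w := f c a b in
  let s := u + v + w in
  ((u * fst A + v * fst B + w * fst C) / s,
   (u * snd A + v * snd B + w * snd C) / s).

Definition d_BC (A B C : point) (f : center) : R :=
  signed_dist_BC A B C (center_point f A B C).

Definition area (a b c : R) : R :=
  let s := (a + b + c) / 2 in sqrt (s * (s - a) * (s - b) * (s - c)).
(** SA = b^2 + c^2 - a^2 (= 2 b c cos A). *)
Definition SA (a b c : R) : R := b ^ 2 + c ^ 2 - a ^ 2.

(** ETC barycentrics (first coordinate), written algebraically
    (trigonometric forms from ETC in comments, using the law of cosines
     cos A = SA/(2bc), sin A = 2 area/(bc)). *)
(* X1 incenter: a *)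
Definition X1 : center := fun a b c => a.
(* X2 centroid: 1 *)
Definition X2 : center := fun a b c => 1.
(* X4 orthocenter: tan A ~ 1/(b^2+c^2-a^2) *)
Definition X4 : center := fun a b c => / SA a b c.
(* X7 Gergonne point: 1/(b+c-a) *)
Definition X7 : center := fun a b c => / (b + c - a).
(* X8 Nagel point: b+c-a *)
Definition X8 : center := fun a b c => b + c - a.
(* X9 Mittenpunkt: a(b+c-a) *)
Definition X9 : center := fun a b c => a * (b + c - a).
(* X10 Spieker center: b+c *)
Definition X10 : center := fun a b c => b + c.
(* X16 second isodynamic point: a sin(A - pi/3) ~ a^2 (4 area - sqrt3 (b^2+c^2-a^2)) *)
Definition X16 : center := fun a b c =>
  a ^ 2 * (4 * area a b c - sqrt 3 * SA a b c).
(* X19 Clawson point: a tan A ~ a/(b^2+c^2-a^2) *)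
Definition X19 : center := fun a b c => a / SA a b c.
(* X20 de Longchamps point: 3a^4 - 2a^2(b^2+c^2) - (b^2-c^2)^2 *)
Definition X20 : center := fun a b c =>
  3 * a ^ 4 - 2 * a ^ 2 * (b ^ 2 + c ^ 2) - (b ^ 2 - c ^ 2) ^ 2.
(* X22 Exeter point: a^2 (b^4 + c^4 - a^4) *)
Definition X22 : center := fun a b c => a ^ 2 * (b ^ 4 + c ^ 4 - a ^ 4).
(* X24: a sec A cos 2A ~ a^2 (SA^2 - 2 b^2 c^2) / SA *)
Definition X24 : center := fun a b c =>
  a ^ 2 * (SA a b c ^ 2 - 2 * b ^ 2 * c ^ 2) / SA a b c.
(* X25: a^2 tan A ~ a^2/(b^2+c^2-a^2) *)
Definition X25 : center := fun a b c => a ^ 2 / SA a b c.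
(* X26 circumcenter of tangential triangle:
   a^2 (b^2 cos 2B + c^2 cos 2C - a^2 cos 2A), cleared of denominators *)
Definition X26 : center := fun a b c =>
  a ^ 2 * (b ^ 4 * (SA b c a ^ 2 - 2 * c ^ 2 * a ^ 2)
         + c ^ 4 * (SA c a b ^ 2 - 2 * a ^ 2 * b ^ 2)
         - a ^ 4 * (SA a b c ^ 2 - 2 * b ^ 2 * c ^ 2)).
(* X27: a sec A/(b+c) ~ 1/((b+c)(b^2+c^2-a^2)) *)
Definition X27 : center := fun a b c => / ((b + c) * SA a b c).
(* X28: a tan A/(b+c) ~ a/((b+c)(b^2+c^2-a^2)) *)
Definition X28 : center := fun a b c => a / ((b + c) * SA a b c).
(* X29: a sec A/(cos B + cos C) ~ 1/(SA (b SB + c SC)) *)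
Definition X29 : center := fun a b c =>
  / (SA a b c * (b * SA b c a + c * SA c a b)).
(* X33: a(1 + sec A) ~ a(b+c-a)/(b^2+c^2-a^2) *)
Definition X33 : center := fun a b c => a * (b + c - a) / SA a b c.
(* X34: a(1 - sec A) ~ a(a^2-(b-c)^2)/(b^2+c^2-a^2) *)
Definition X34 : center := fun a b c => a * (a ^ 2 - (b - c) ^ 2) / SA a b c.
(* X36: a(1 - 2 cos A) ~ a^2 (a^2 - b^2 - c^2 + b c) *)
Definition X36 : center := fun a b c => a ^ 2 * (a ^ 2 - b ^ 2 - c ^ 2 + b * c).
Definition X37 : center := fun a b c => a * (b + c).
(* X40 Bevan point: a(a^3 + a^2(b+c) - a(b+c)^2 - (b+c)(b-c)^2) *)
Definition X40 : center := fun a b c =>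
  a * (a ^ 3 + a ^ 2 * (b + c) - a * (b + c) ^ 2 - (b + c) * (b - c) ^ 2).

(* Main.v *)
Require Import Defs.
From Stdlib Require Import Reals Lra.
Open Scope R_scope.

(** With [h] the altitude from [A], a point with barycentrics [u : v : w] has
    signed distance [h * u / (u + v + w)].  So each comparison amounts, once both
    coordinate sums are normalised to be positive, to
    [u' * (v + w) < u * (v' + w')].  For about half of the consecutive pairs the
    second center is the first one multiplied coordinatewise by a weight that is
    smallest at [a], and the inequality is immediate.  For the others the
    difference of the two sides, after removal of positive factors, is a
    polynomial symmetric in [b] and [c] which, written in [a], [x = b - a] and
    [y = c - b >= 0], has only nonnegative coefficients; the comparison of [X29]
    and [X33] additionally uses acuteness in the form [y * (2a + 2x + y) < a^2].
    For [X16] the difference is [sqrt 3 * F - 4 * area * G], and the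
    polynomial is [3 * F^2 - 16 * area^2 * G^2]. *)

(** * Side lengths of an acute triangle with smallest side [a] *)

Definition acute_min_side (a b c : R) : Prop :=
  0 < a /\ a < b /\ a < c /\ 0 < SA b c a /\ 0 < SA c a b.

(** Acuteness gives [c ^ 2 < a ^ 2 + b ^ 2 < (a + b) ^ 2], and likewise for [b]. *)
Lemma acute_min_side_triangle (a b c : R) :
  acute_min_side a b c ->
  0 < a /\ a < b /\ a < c /\ 0 < b + c - a /\ 0 < c + a - b /\ 0 < a + b - c.
Proof.
  unfold acute_min_side, SA; intros (Ha & Hb & Hc & HB & HC).
  repeat split; try lra; nra.
Qed.

Lemma acute_min_side_SA (a b c : R) :
  acute_min_side a b c -> 0 < SA a b c /\ 0 < SA b c a /\ 0 < SA c a b.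
Proof.
  unfold acute_min_side, SA; intros (Ha & Hb & Hc & HB & HC).
  repeat split; try assumption; nra.
Qed.

(** * Comparing barycentric shares *)

Definition coord_sum (f : center) (a b c : R) : R :=
  f a b c + f b c a + f c a b.

Definition share (f : center) (a b c : R) : R := f a b c / coord_sum f a b c.

(** Nonzero sums are part of the relation because [center_point] divides by them. *)
Definition farther (f g : center) (a b c : R) : Prop :=
  coord_sum f a b c <> 0 /\ coord_sum g a b c <> 0 /\
  share g a b c < share f a b c.

(** Barycentrics are homogeneous, so [k] and [k'] may clear denominators or reverse signs. Over a
    common denominator the products [u * u'] cancel, leaving the cross difference of the last
    hypothesis. *)
Lemma farther_scaled (f g : center) (a b c k u v w k' u' v' w' : R) :
  k <> 0 -> f a b c = k * u -> f b c a = k * v -> f c a b = k * w ->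
  k' <> 0 -> g a b c = k' * u' -> g b c a = k' * v' -> g c a b = k' * w' ->
  0 < u + v + w -> 0 < u' + v' + w' ->
  0 < u * (v' + w') - u' * (v + w) ->
  farther f g a b c.
Proof.
  intros Hk fa fb fc Hk' ga gb gc Hs Hs' Hd.
  unfold farther, share, coord_sum; rewrite fa, fb, fc, ga, gb, gc.
  replace (k * u + k * v + k * w) with (k * (u + v + w)) by ring.
  replace (k' * u' + k' * v' + k' * w') with (k' * (u' + v' + w')) by ring.
  split; [apply Rmult_integral_contrapositive_currified; lra|].
  split; [apply Rmult_integral_contrapositive_currified; lra|].
  apply Rlt_0_minus.
  replace (k * u / (k * (u + v + w)) - k' * u' / (k' * (u' + v' + w')))
    with ((u * (v' + w') - u' * (v + w)) / ((u + v + w) * (u' + v' + w')))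
    by (field; lra).
  apply Rdiv_lt_0_compat; [assumption|apply Rmult_lt_0_compat; assumption].
Qed.

(** A weight smallest at the first coordinate pulls the point towards [BC]: the cross difference
    factors as in [E] below. *)
Lemma farther_weighted (f g : center) (a b c k p q r : R) :
  0 < f a b c -> 0 < f b c a -> 0 < f c a b ->
  k <> 0 -> 0 < p -> p < q -> p < r ->
  g a b c = k * (f a b c * p) -> g b c a = k * (f b c a * q) ->
  g c a b = k * (f c a b * r) ->
  farther f g a b c.
Proof.
  intros fa fb fc Hk Hp Hq Hr ga gb gc.
  assert (E : 0 < f a b c * (f b c a * (q - p) + f c a b * (r - p))).
  { apply Rmult_lt_0_compat; [assumption|].
    apply Rplus_lt_0_compat; apply Rmult_lt_0_compat; lra. }
  apply farther_scaled with (k := 1) (u := f a b c) (v := f b c a) (w := f c a b)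
    (k' := k) (u' := f a b c * p) (v' := f b c a * q) (w' := f c a b * r);
    try assumption; try lra.
  repeat apply Rplus_lt_0_compat; apply Rmult_lt_0_compat; lra.
Qed.

(** * Positivity of symmetric polynomials *)

(** For [b = a + x] and [c = a + x + y], the bound on [y] is exactly [c ^ 2 < a ^ 2 + b ^ 2],
    acuteness at [C]. *)
Lemma wlog_sides_sorted (Q : R -> R -> R -> Prop) :
  (forall a b c, Q a c b -> Q a b c) ->
  (forall a x y, 0 < a -> 0 < x -> 0 <= y -> y * (2 * a + 2 * x + y) < a ^ 2 ->
     Q a (a + x) (a + x + y)) ->
  forall a b c, acute_min_side a b c -> Q a b c.
Proof.
  intros Hsym HQ a b c (Ha & Hb & Hc & HB & HC); unfold SA in HB, HC.
  destruct (Rle_lt_dec b c) as [bc|cb].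
  - replace c with (a + (b - a) + (c - b)) by ring.
    replace b with (a + (b - a)) at 1 by ring.
    apply HQ; lra || nra.
  - apply Hsym.
    replace b with (a + (c - a) + (b - c)) by ring.
    replace c with (a + (c - a)) at 1 by ring.
    apply HQ; lra || nra.
Qed.

Ltac monomial_pos :=
  repeat first [apply Rmult_lt_0_compat | apply pow_lt]; lra.
Ltac monomial_nonneg :=
  repeat first [apply Rmult_le_pos | apply pow_le]; lra.
(** Since [y] may vanish, the leftmost monomial, which must be strictly positive, has to be free of
    [y]; the others need only be nonnegative. *)
Ltac sum_pos :=
  first [apply Rplus_lt_le_0_compat; [sum_pos | monomial_nonneg] | monomial_pos].
Ltac sort_sides a b c H :=
  pattern a, b, c;
  match goal with |- ?Q a b c =>
    refine (wlog_sides_sorted Q _ _ a b c H);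
    [ intros ? ? ? H'; eapply Rlt_le_trans; [exact H' | right; ring]
    | cbv beta; clear; intros a x y ? ? ? ? ]
  end.
Ltac sym_poly_pos a b c H :=
  unfold SA; sort_sides a b c H; ring_simplify; sum_pos.

(** Cofactor of the Heron product in the cross difference of [X26] and [X20]. *)
Lemma poly_26_20_pos (a b c : R) (H : acute_min_side a b c) :
  0 < - 2 * a ^ 10 + a ^ 8 * (3 * b ^ 2 + 3 * c ^ 2)
      + a ^ 6 * (2 * b ^ 4 - 12 * b ^ 2 * c ^ 2 + 2 * c ^ 4)
      + a ^ 4 * (- 4 * b ^ 6 + 6 * b ^ 4 * c ^ 2 + 6 * b ^ 2 * c ^ 4 - 4 * c ^ 6)
      + a ^ 2 * (6 * b ^ 6 * c ^ 2 - 12 * b ^ 4 * c ^ 4 + 6 * b ^ 2 * c ^ 6)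
      + (b ^ 10 - 3 * b ^ 8 * c ^ 2 + 2 * b ^ 6 * c ^ 4 + 2 * b ^ 4 * c ^ 6
         - 3 * b ^ 2 * c ^ 8 + c ^ 10).
Proof. sym_poly_pos a b c H. Qed.

(** Cofactor of [(b + c - a) * (c + a - b) * (a + b - c)] in the cross difference of [X7] and [X29]
    after clearing denominators. *)
Lemma poly_7_29_pos (a b c : R) (H : acute_min_side a b c) :
  0 < - 2 * a ^ 9 + a ^ 7 * (b ^ 2 + c ^ 2)
      + a ^ 6 * (3 * b ^ 3 - 3 * b ^ 2 * c - 3 * b * c ^ 2 + 3 * c ^ 3)
      + a ^ 5 * (5 * b ^ 4 - 10 * b ^ 2 * c ^ 2 + 5 * c ^ 4)
      + a ^ 4 * (- 5 * b ^ 5 + 5 * b ^ 4 * c + 5 * b * c ^ 4 - 5 * c ^ 5)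
      + a ^ 3 * (- 5 * b ^ 6 + 5 * b ^ 4 * c ^ 2 + 5 * b ^ 2 * c ^ 4 - 5 * c ^ 6)
      + a ^ 2 * (b ^ 7 - b ^ 6 * c + 5 * b ^ 5 * c ^ 2 - 5 * b ^ 4 * c ^ 3
                 - 5 * b ^ 3 * c ^ 4 + 5 * b ^ 2 * c ^ 5 - b * c ^ 6 + c ^ 7)
      + a * (b ^ 8 + 4 * b ^ 6 * c ^ 2 - 10 * b ^ 4 * c ^ 4 + 4 * b ^ 2 * c ^ 6
             + c ^ 8)
      + (b ^ 9 - b ^ 8 * c - 2 * b ^ 7 * c ^ 2 + 2 * b ^ 6 * c ^ 3
         + 2 * b ^ 3 * c ^ 6 - 2 * b ^ 2 * c ^ 7 - b * c ^ 8 + c ^ 9).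
Proof. sym_poly_pos a b c H. Qed.

Lemma poly_29_33_pos (a b c : R) (H : acute_min_side a b c) :
  0 < - a ^ 5 * (b + c) - a ^ 4 * (b - c) ^ 2 + a ^ 3 * (b ^ 3 + c ^ 3)
      + a ^ 2 * (b ^ 4 - b ^ 3 * c - b * c ^ 3 + c ^ 4)
      + a * (b ^ 4 * c - b ^ 3 * c ^ 2 - b ^ 2 * c ^ 3 + b * c ^ 4)
      - b * c * (b ^ 2 - c ^ 2) ^ 2.
Proof.
  sort_sides a b c H.
  (* Here [t] is [a ^ 2 + b ^ 2 - c ^ 2]. Expanding in [a], [x], [y] alone would leave negative
     terms, those free of [a] coming from [- b * c * (b ^ 2 - c ^ 2) ^ 2]; with [t] as a further
     variable all coefficients are positive. *)
  set (t := a ^ 2 - y * (2 * a + 2 * x + y)).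
  assert (0 < t) by (unfold t; lra).
  assert (0 < 2 * x ^ 3 * a * t + 4 * x * a * t ^ 2 + 6 * x ^ 2 * t ^ 2
    + 4 * a * x ^ 4 * y + 66 * a * x ^ 3 * y ^ 2
    + 202 * a * x ^ 2 * y ^ 3 + 43 * a * x ^ 2 * y * t + 222 * a * x * y ^ 4
    + 87 * a * x * y ^ 2 * t + 82 * a * y ^ 5
    + 39 * a * y ^ 3 * t + 2 * a * y * t ^ 2 + 28 * x ^ 4 * y ^ 2
    + 138 * x ^ 3 * y ^ 3 + 28 * x ^ 3 * y * t + 226 * x ^ 2 * y ^ 4
    + 115 * x ^ 2 * y ^ 2 * t + 150 * x * y ^ 5
    + 127 * x * y ^ 3 * t + 22 * x * y * t ^ 2 + 34 * y ^ 6 + 45 * y ^ 4 * t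
    + 11 * y ^ 2 * t ^ 2) as E by sum_pos.
  eapply Rlt_le_trans; [exact E|right; unfold t; ring].
Qed.

(* The same polynomial controls the pairs (X34, X24) and (X24, X36). *)
Lemma poly_24_pos (a b c : R) (H : acute_min_side a b c) :
  0 < - a ^ 8 * (b + c) + 6 * a ^ 7 * b * c
      + a ^ 6 * (2 * b ^ 3 - 4 * b ^ 2 * c - 4 * b * c ^ 2 + 2 * c ^ 3)
      + a ^ 5 * (- 8 * b ^ 3 * c + 12 * b ^ 2 * c ^ 2 - 8 * b * c ^ 3)
      + a ^ 4 * (8 * b ^ 4 * c - 6 * b ^ 3 * c ^ 2 - 6 * b ^ 2 * c ^ 3
                 + 8 * b * c ^ 4)
      + a ^ 3 * (- 2 * b ^ 5 * c - 6 * b ^ 4 * c ^ 2 + 16 * b ^ 3 * c ^ 3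
                 - 6 * b ^ 2 * c ^ 4 - 2 * b * c ^ 5)
      + a ^ 2 * (- 2 * b ^ 7 + 10 * b ^ 5 * c ^ 2 - 8 * b ^ 4 * c ^ 3
                 - 8 * b ^ 3 * c ^ 4 + 10 * b ^ 2 * c ^ 5 - 2 * c ^ 7)
      + a * (4 * b ^ 7 * c - 6 * b ^ 6 * c ^ 2 - 4 * b ^ 5 * c ^ 3
             + 12 * b ^ 4 * c ^ 4 - 4 * b ^ 3 * c ^ 5 - 6 * b ^ 2 * c ^ 6
             + 4 * b * c ^ 7)
      + (b ^ 9 - 3 * b ^ 8 * c + 8 * b ^ 6 * c ^ 3 - 6 * b ^ 5 * c ^ 4
         - 6 * b ^ 4 * c ^ 5 + 8 * b ^ 3 * c ^ 6 - 3 * b * c ^ 8 + c ^ 9).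
Proof. sym_poly_pos a b c H. Qed.

(** By Heron's formula this is [16 * area a b c ^ 2]. Up to sign and positive factors it is the
    coordinate sum of [X20], [X26] and [X40]. *)
Lemma heron_product_pos (a b c : R) (H : acute_min_side a b c) :
  0 < (a + b + c) * (b + c - a) * (c + a - b) * (a + b - c).
Proof.
  destruct (acute_min_side_triangle a b c H) as (? & ? & ? & ? & ? & ?).
  repeat apply Rmult_lt_0_compat; lra.
Qed.

Ltac pos :=
  first [ lra
        | first [ apply Rplus_lt_0_compat | apply Rdiv_lt_0_compat
                | apply Rmult_lt_0_compat | apply Rinv_0_lt_compat
                | apply pow_lt ]; pos ].
Ltac sides H :=
  match type of H with acute_min_side ?a ?b ?c =>
    destruct (acute_min_side_triangle a b c H) as (? & ? & ? & ? & ? & ?);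
    destruct (acute_min_side_SA a b c H) as (? & ? & ?)
  end.
Ltac pos_eq F := apply Rlt_le_trans with F; [ | right; unfold SA; ring].

(** * The chain, pair by pair *)

Lemma side_times_excess_lt (a b c : R) :
  a < b -> 0 < a + b - c -> b * (c + a - b) < a * (b + c - a).
Proof.
  intros; apply Rlt_0_minus.
  replace (a * (b + c - a) - b * (c + a - b)) with ((b - a) * (a + b - c)) by ring.
  pos.
Qed.

(** The weight leading from [X1] to [X7], from [X33] to [X4] and, up to a symmetric factor, from
    [X25] to [X34]. *)
Lemma inv_side_times_excess_lt (a b c : R) (H : acute_min_side a b c) :
  0 < / (a * (b + c - a)) /\
  / (a * (b + c - a)) < / (b * (c + a - b)) /\
  / (a * (b + c - a)) < / (c * (a + b - c)).
Proof.
  sides H; split; [pos|split]; apply Rinv_lt_contravar.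
  - pos.
  - apply side_times_excess_lt; lra.
  - pos.
  - replace (a + b - c) with (b + a - c) by ring.
    replace (b + c - a) with (c + b - a) by ring.
    apply side_times_excess_lt; lra.
Qed.

(** The weight leading from [X10] to [X2], [X37] to [X1], [X4] to [X27] and [X19] to [X28]. *)
Lemma inv_side_sum_lt (a b c : R) (H : acute_min_side a b c) :
  0 < / (b + c) /\ / (b + c) < / (c + a) /\ / (b + c) < / (a + b).
Proof.
  sides H; split; [pos|split]; apply Rinv_lt_contravar; pos.
Qed.

(** The weight leading from [X2] to [X37], [X27] to [X19] and [X28] to [X25]; the gaps are
    [c * (b - a)] and [b * (c - a)]. *)
Lemma side_times_sum_lt (a b c : R) (H : acute_min_side a b c) :
  0 < a * (b + c) /\ a * (b + c) < b * (c + a) /\ a * (b + c) < c * (a + b).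
Proof. sides H; split; [pos|split; nra]. Qed.

(** Both coordinate sums are negative, hence the two scales [-1]. *)
Lemma farther_26_20 (a b c : R) (H : acute_min_side a b c) :
  farther X26 X20 a b c.
Proof.
  pose proof (heron_product_pos a b c H) as Hh; sides H.
  apply farther_scaled with
    (k := -1) (u := - X26 a b c) (v := - X26 b c a) (w := - X26 c a b)
    (k' := -1) (u' := - X20 a b c) (v' := - X20 b c a) (w' := - X20 c a b);
    try lra; unfold X26, X20.
  - pos_eq (SA a b c * SA b c a * SA c a b *
            ((a + b + c) * (b + c - a) * (c + a - b) * (a + b - c))).
    pos.
  - pos_eq ((a + b + c) * (b + c - a) * (c + a - b) * (a + b - c)); exact Hh.
  - eapply Rlt_le_trans;
      [exact (Rmult_lt_0_compat _ _ Hh (poly_26_20_pos a b c H)) |].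
    right; unfold SA; ring.
Qed.

Lemma sum_22_pos (a b c : R) (H : acute_min_side a b c) :
  0 < X22 a b c + X22 b c a + X22 c a b.
Proof.
  sides H; unfold X22.
  pos_eq (a ^ 4 * SA a b c + b ^ 4 * SA b c a + c ^ 4 * SA c a b); pos.
Qed.

Lemma farther_20_22 (a b c : R) (H : acute_min_side a b c) :
  farther X20 X22 a b c.
Proof.
  pose proof (heron_product_pos a b c H) as Hh.
  pose proof (sum_22_pos a b c H); sides H.
  apply farther_scaled with
    (k := -1) (u := - X20 a b c) (v := - X20 b c a) (w := - X20 c a b)
    (k' := 1) (u' := X22 a b c) (v' := X22 b c a) (w' := X22 c a b);
    try lra; unfold X20, X22.
  - pos_eq ((a + b + c) * (b + c - a) * (c + a - b) * (a + b - c)); exact Hh.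
  (* The last factor is positive because [2 * a ^ 2 < b ^ 2 + c ^ 2]. *)
  - pos_eq (SA a b c * SA b c a * SA c a b *
            ((b ^ 2 - c ^ 2) ^ 2 + a ^ 2 * (b ^ 2 + c ^ 2 - 2 * a ^ 2))).
    apply Rmult_lt_0_compat; [pos|].
    apply Rplus_le_lt_0_compat; [apply pow2_ge_0|].
    apply Rmult_lt_0_compat; [pos|nra].
Qed.

Lemma farther_22_40 (a b c : R) (H : acute_min_side a b c) :
  farther X22 X40 a b c.
Proof.
  pose proof (heron_product_pos a b c H) as Hh.
  pose proof (sum_22_pos a b c H).
  apply farther_scaled with
    (k := 1) (u := X22 a b c) (v := X22 b c a) (w := X22 c a b)
    (k' := -1) (u' := - X40 a b c) (v' := - X40 b c a) (w' := - X40 c a b);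
    try lra; unfold X40, X22.
  - pos_eq ((a + b + c) * (b + c - a) * (c + a - b) * (a + b - c)); exact Hh.
  - sym_poly_pos a b c H.
Qed.

Lemma farther_40_8 (a b c : R) (H : acute_min_side a b c) :
  farther X40 X8 a b c.
Proof.
  pose proof (heron_product_pos a b c H) as Hh; sides H.
  apply farther_scaled with
    (k := -1) (u := - X40 a b c) (v := - X40 b c a) (w := - X40 c a b)
    (k' := 1) (u' := X8 a b c) (v' := X8 b c a) (w' := X8 c a b);
    try lra; unfold X40, X8.
  - pos_eq ((a + b + c) * (b + c - a) * (c + a - b) * (a + b - c)); exact Hh.
  - lra.
  - sym_poly_pos a b c H.
Qed.

Lemma farther_8_9 (a b c : R) (H : acute_min_side a b c) :
  farther X8 X9 a b c.
Proof.
  sides H.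
  apply farther_weighted with (k := 1) (p := a) (q := b) (r := c);
    unfold X8, X9; lra || ring.
Qed.

Lemma farther_9_10 (a b c : R) (H : acute_min_side a b c) :
  farther X9 X10 a b c.
Proof.
  sides H.
  apply farther_scaled with
    (k := 1) (u := X9 a b c) (v := X9 b c a) (w := X9 c a b)
    (k' := 1) (u' := X10 a b c) (v' := X10 b c a) (w' := X10 c a b);
    try lra; unfold X9, X10.
  - pos.
  - pos.
  - sym_poly_pos a b c H.
Qed.

Lemma farther_10_2 (a b c : R) (H : acute_min_side a b c) :
  farther X10 X2 a b c.
Proof.
  pose proof (inv_side_sum_lt a b c H); sides H.
  apply farther_weighted with
    (k := 1) (p := / (b + c)) (q := / (c + a)) (r := / (a + b));
    unfold X10, X2; try lra; field; lra.
Qed.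

Lemma farther_2_37 (a b c : R) (H : acute_min_side a b c) :
  farther X2 X37 a b c.
Proof.
  pose proof (side_times_sum_lt a b c H); sides H.
  apply farther_weighted with
    (k := 1) (p := a * (b + c)) (q := b * (c + a)) (r := c * (a + b));
    unfold X2, X37; lra.
Qed.

Lemma farther_37_1 (a b c : R) (H : acute_min_side a b c) :
  farther X37 X1 a b c.
Proof.
  pose proof (inv_side_sum_lt a b c H); sides H.
  apply farther_weighted with
    (k := 1) (p := / (b + c)) (q := / (c + a)) (r := / (a + b));
    unfold X37, X1; try pos; field; lra.
Qed.

Lemma farther_1_7 (a b c : R) (H : acute_min_side a b c) :
  farther X1 X7 a b c.
Proof.
  pose proof (inv_side_times_excess_lt a b c H); sides H.
  apply farther_weighted with (k := 1) (p := / (a * (b + c - a)))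
    (q := / (b * (c + a - b))) (r := / (c * (a + b - c)));
    unfold X1, X7; try lra; field; lra.
Qed.

Lemma farther_7_29 (a b c : R) (H : acute_min_side a b c) :
  farther X7 X29 a b c.
Proof.
  sides H.
  assert (0 < b * SA b c a + c * SA c a b) by pos.
  assert (0 < c * SA c a b + a * SA a b c) by pos.
  assert (0 < a * SA a b c + b * SA b c a) by pos.
  apply farther_scaled with
    (* Scaling by the product of the three denominators turns each coordinate into the product of
       the other two denominators. *)
    (k := / ((b + c - a) * (c + a - b) * (a + b - c)))
    (u := (c + a - b) * (a + b - c)) (v := (a + b - c) * (b + c - a))
    (w := (b + c - a) * (c + a - b))
    (k' := / (SA a b c * SA b c a * SA c a b * ((b * SA b c a + c * SA c a b)
             * (c * SA c a b + a * SA a b c) * (a * SA a b c + b * SA b c a))))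
    (u' := SA b c a * SA c a b *
      ((c * SA c a b + a * SA a b c) * (a * SA a b c + b * SA b c a)))
    (v' := SA c a b * SA a b c *
      ((a * SA a b c + b * SA b c a) * (b * SA b c a + c * SA c a b)))
    (w' := SA a b c * SA b c a *
      ((b * SA b c a + c * SA c a b) * (c * SA c a b + a * SA a b c)));
    unfold X7, X29.
  - apply Rgt_not_eq; pos.
  - field; lra.
  - field; lra.
  - field; lra.
  - apply Rgt_not_eq; pos.
  - field; lra.
  - field; lra.
  - field; lra.
  - pos.
  - pos.
  - assert (0 < (b + c - a) * (c + a - b) * (a + b - c)) as Hx by pos.
    eapply Rlt_le_trans;
      [exact (Rmult_lt_0_compat _ _ Hx (poly_7_29_pos a b c H)) |].
    right; unfold SA; ring.
Qed.

Lemma farther_29_33 (a b c : R) (H : acute_min_side a b c) :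
  farther X29 X33 a b c.
Proof.
  sides H.
  assert (0 < b * SA b c a + c * SA c a b) by pos.
  assert (0 < c * SA c a b + a * SA a b c) by pos.
  assert (0 < a * SA a b c + b * SA b c a) by pos.
  apply farther_scaled with
    (k := / (SA a b c * SA b c a * SA c a b * ((b * SA b c a + c * SA c a b)
             * (c * SA c a b + a * SA a b c) * (a * SA a b c + b * SA b c a))))
    (u := SA b c a * SA c a b *
      ((c * SA c a b + a * SA a b c) * (a * SA a b c + b * SA b c a)))
    (v := SA c a b * SA a b c *
      ((a * SA a b c + b * SA b c a) * (b * SA b c a + c * SA c a b)))
    (w := SA a b c * SA b c a *
      ((b * SA b c a + c * SA c a b) * (c * SA c a b + a * SA a b c)))
    (k' := / (SA a b c * SA b c a * SA c a b))
    (u' := a * (b + c - a) * (SA b c a * SA c a b))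
    (v' := b * (c + a - b) * (SA c a b * SA a b c))
    (w' := c * (a + b - c) * (SA a b c * SA b c a));
    unfold X29, X33.
  - apply Rgt_not_eq; pos.
  - field; lra.
  - field; lra.
  - field; lra.
  - apply Rgt_not_eq; pos.
  - field; lra.
  - field; lra.
  - field; lra.
  - pos.
  - pos.
  - assert (0 < SA a b c * SA b c a * SA c a b *
      ((b + c - a) ^ 2 * (c + a - b) * (a + b - c))) as Hx by pos.
    eapply Rlt_le_trans;
      [exact (Rmult_lt_0_compat _ _ Hx (poly_29_33_pos a b c H)) |].
    right; unfold SA; ring.
Qed.

Lemma farther_33_4 (a b c : R) (H : acute_min_side a b c) :
  farther X33 X4 a b c.
Proof.
  pose proof (inv_side_times_excess_lt a b c H); sides H.
  apply farther_weighted with (k := 1) (p := / (a * (b + c - a)))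
    (q := / (b * (c + a - b))) (r := / (c * (a + b - c)));
    unfold X33, X4; try pos; field; lra.
Qed.

Lemma farther_4_27 (a b c : R) (H : acute_min_side a b c) :
  farther X4 X27 a b c.
Proof.
  pose proof (inv_side_sum_lt a b c H); sides H.
  apply farther_weighted with
    (k := 1) (p := / (b + c)) (q := / (c + a)) (r := / (a + b));
    unfold X4, X27; try pos; field; lra.
Qed.

Lemma farther_27_19 (a b c : R) (H : acute_min_side a b c) :
  farther X27 X19 a b c.
Proof.
  pose proof (side_times_sum_lt a b c H); sides H.
  apply farther_weighted with
    (k := 1) (p := a * (b + c)) (q := b * (c + a)) (r := c * (a + b));
    unfold X27, X19; try pos; field; lra.
Qed.

Lemma farther_19_28 (a b c : R) (H : acute_min_side a b c) :
  farther X19 X28 a b c.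
Proof.
  pose proof (inv_side_sum_lt a b c H); sides H.
  apply farther_weighted with
    (k := 1) (p := / (b + c)) (q := / (c + a)) (r := / (a + b));
    unfold X19, X28; try pos; field; lra.
Qed.

Lemma farther_28_25 (a b c : R) (H : acute_min_side a b c) :
  farther X28 X25 a b c.
Proof.
  pose proof (side_times_sum_lt a b c H); sides H.
  apply farther_weighted with
    (k := 1) (p := a * (b + c)) (q := b * (c + a)) (r := c * (a + b));
    unfold X28, X25; try pos; field; lra.
Qed.

(* The weight (a^2 - (b-c)^2)/a equals (b+c-a)(c+a-b)(a+b-c) / (a(b+c-a)). *)
Lemma farther_25_34 (a b c : R) (H : acute_min_side a b c) :
  farther X25 X34 a b c.
Proof.
  pose proof (inv_side_times_excess_lt a b c H); sides H.
  apply farther_weighted with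
    (k := (b + c - a) * (c + a - b) * (a + b - c)) (p := / (a * (b + c - a)))
    (q := / (b * (c + a - b))) (r := / (c * (a + b - c)));
    unfold X25, X34; try pos; try (field; lra).
  apply Rgt_not_eq; pos.
Qed.

(** Besides clearing denominators this reverses the sign, which makes the coordinate sum positive.
    The first coordinate is still negative when the angle at [A] is below 45 degrees. *)
Definition X24_cleared (a b c : R) : R :=
  a ^ 2 * (2 * b ^ 2 * c ^ 2 - SA a b c ^ 2) * (SA b c a * SA c a b).

Lemma X24_scaled (a b c : R) :
  SA a b c <> 0 -> SA b c a <> 0 -> SA c a b <> 0 ->
  X24 a b c = - / (SA a b c * SA b c a * SA c a b) * X24_cleared a b c.
Proof. intros; unfold X24, X24_cleared; field; auto. Qed.

Lemma sum_24_pos (a b c : R) (H : acute_min_side a b c) :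
  0 < X24_cleared a b c + X24_cleared b c a + X24_cleared c a b.
Proof.
  pose proof (heron_product_pos a b c H) as Hh.
  assert (0 < a ^ 6 - a ^ 4 * (b ^ 2 + c ^ 2)
    + a ^ 2 * (4 * b ^ 2 * c ^ 2 - b ^ 4 - c ^ 4)
    + (b ^ 6 - b ^ 4 * c ^ 2 - b ^ 2 * c ^ 4 + c ^ 6)) as E
    by sym_poly_pos a b c H.
  eapply Rlt_le_trans; [exact (Rmult_lt_0_compat _ _ Hh E)|].
  right; unfold X24_cleared, SA; ring.
Qed.

Lemma farther_34_24 (a b c : R) (H : acute_min_side a b c) :
  farther X34 X24 a b c.
Proof.
  pose proof (sum_24_pos a b c H); sides H.
  apply farther_scaled with
    (k := / (SA a b c * SA b c a * SA c a b))
    (u := a * ((c + a - b) * (a + b - c)) * (SA b c a * SA c a b))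
    (v := b * ((a + b - c) * (b + c - a)) * (SA c a b * SA a b c))
    (w := c * ((b + c - a) * (c + a - b)) * (SA a b c * SA b c a))
    (k' := - / (SA a b c * SA b c a * SA c a b))
    (u' := X24_cleared a b c) (v' := X24_cleared b c a) (w' := X24_cleared c a b).
  - apply Rgt_not_eq; pos.
  - unfold X34; field; lra.
  - unfold X34; field; lra.
  - unfold X34; field; lra.
  - apply Ropp_neq_0_compat, Rgt_not_eq; pos.
  - apply X24_scaled; lra.
  (* The cyclic shift only permutes the factors of the scale. *)
  - rewrite X24_scaled by lra; f_equal; f_equal; f_equal; ring.
  - rewrite X24_scaled by lra; f_equal; f_equal; f_equal; ring.
  - pos.
  - assumption.
  - assert (0 < a * (SA a b c * SA b c a * SA c a b) * (a + b + c)) as Hx by pos.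
    eapply Rlt_le_trans;
      [exact (Rmult_lt_0_compat _ _ Hx (poly_24_pos a b c H)) |].
    right; unfold X24_cleared, SA; ring.
Qed.

Lemma sum_36_pos (a b c : R) (H : acute_min_side a b c) :
  0 < X36 a b c + X36 b c a + X36 c a b.
Proof. unfold X36; sym_poly_pos a b c H. Qed.

Lemma farther_24_36 (a b c : R) (H : acute_min_side a b c) :
  farther X24 X36 a b c.
Proof.
  pose proof (sum_24_pos a b c H); pose proof (sum_36_pos a b c H); sides H.
  apply farther_scaled with
    (k := - / (SA a b c * SA b c a * SA c a b))
    (u := X24_cleared a b c) (v := X24_cleared b c a) (w := X24_cleared c a b)
    (k' := 1) (u' := X36 a b c) (v' := X36 b c a) (w' := X36 c a b);
    try lra.
  - apply Ropp_neq_0_compat, Rgt_not_eq; pos.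
  - apply X24_scaled; lra.
  - rewrite X24_scaled by lra; f_equal; f_equal; f_equal; ring.
  - rewrite X24_scaled by lra; f_equal; f_equal; f_equal; ring.
  - assert (0 < a ^ 2 * b * c * (a + b + c)) as Hx by pos.
    eapply Rlt_le_trans;
      [exact (Rmult_lt_0_compat _ _ Hx (poly_24_pos a b c H)) |].
    right; unfold X24_cleared, X36, SA; ring.
Qed.

(** * Area, Weitzenboeck's inequality and the pair [X36], [X16] *)

Lemma area_cyclic (a b c : R) : area b c a = area a b c.
Proof. unfold area; f_equal; field. Qed.

Lemma area_sqr (a b c : R) (H : acute_min_side a b c) :
  16 * area a b c ^ 2 = (a + b + c) * (b + c - a) * (c + a - b) * (a + b - c).
Proof.
  pose proof (heron_product_pos a b c H); unfold area.
  rewrite pow2_sqrt; [field|].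
  match goal with |- 0 <= ?e =>
    replace e with ((a + b + c) * (b + c - a) * (c + a - b) * (a + b - c) / 16)
      by field
  end.
  lra.
Qed.

Lemma area_pos (a b c : R) (H : acute_min_side a b c) : 0 < area a b c.
Proof. sides H; unfold area; apply sqrt_lt_R0; pos. Qed.

(** Only [y] must be positive, so a left side of unknown sign can be squared. *)
Lemma sqr_lt_reg (x y : R) : 0 < y -> x ^ 2 < y ^ 2 -> x < y.
Proof. intros; nra. Qed.

(** Makes the coordinate sum of [X16] positive. After squaring, the gap is twice the sum of the
    squared differences of [a ^ 2], [b ^ 2], [c ^ 2], and it is strict since [a < b]. *)
Lemma weitzenboeck (a b c : R) (H : acute_min_side a b c) :
  4 * sqrt 3 * area a b c < a ^ 2 + b ^ 2 + c ^ 2.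
Proof.
  pose proof (area_sqr a b c H) as HS.
  sides H; apply sqr_lt_reg; [pos|].
  replace ((4 * sqrt 3 * area a b c) ^ 2)
    with (sqrt 3 ^ 2 * (16 * area a b c ^ 2)) by ring.
  rewrite HS, pow2_sqrt by lra.
  apply Rlt_0_minus.
  pos_eq (2 * ((a ^ 2 - b ^ 2) ^ 2 + (b ^ 2 - c ^ 2) ^ 2 + (c ^ 2 - a ^ 2) ^ 2)).
  assert (0 < b ^ 2 - a ^ 2) by nra.
  pose proof (pow2_ge_0 (b ^ 2 - c ^ 2)); pose proof (pow2_ge_0 (c ^ 2 - a ^ 2)).
  assert (0 < (b ^ 2 - a ^ 2) ^ 2) by pos.
  replace ((a ^ 2 - b ^ 2) ^ 2) with ((b ^ 2 - a ^ 2) ^ 2) by ring; lra.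
Qed.

Lemma farther_36_16 (a b c : R) (H : acute_min_side a b c) :
  farther X36 X16 a b c.
Proof.
  pose proof (sum_36_pos a b c H); pose proof (area_pos a b c H).
  pose proof (weitzenboeck a b c H); pose proof (area_sqr a b c H) as HS.
  (* The coordinates of [X16] call [area] on cyclically shifted sides; these equations reduce all of
     them to one area. *)
  pose proof (area_cyclic a b c) as E1; pose proof (area_cyclic b c a) as E2.
  rewrite E1 in E2.
  apply farther_scaled with
    (k := 1) (u := X36 a b c) (v := X36 b c a) (w := X36 c a b)
    (k' := 1) (u' := X16 a b c) (v' := X16 b c a) (w' := X16 c a b);
    try lra; unfold X16, X36; rewrite ?E2, ?E1; set (S := area a b c) in *.
  - apply Rlt_le_trans with
      (4 * S * (a ^ 2 + b ^ 2 + c ^ 2 - 4 * sqrt 3 * S)); [pos|right].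
    replace (4 * S * (a ^ 2 + b ^ 2 + c ^ 2 - 4 * sqrt 3 * S))
      with (4 * S * (a ^ 2 + b ^ 2 + c ^ 2) - sqrt 3 * (16 * S ^ 2)) by ring.
    rewrite HS; unfold SA; ring.
  (* The cross difference is linear in [sqrt 3] and [S]: up to the factor [a ^ 2], [F] is the
     coefficient of [sqrt 3] and [- G] that of [4 * S]. *)
  - set (F := b * c * (a * SA a b c * (a + b + c)
             - (a + b + c) * (b + c - a) * (c + a - b) * (a + b - c))).
    set (G := a * b * c * (a + b + c)
             - (a + b + c) * (b + c - a) * (c + a - b) * (a + b - c)
             + (SA a b c - b * c) * (a ^ 2 + b ^ 2 + c ^ 2)).
    assert (HF : 0 < F) by (unfold F; sym_poly_pos a b c H).
    assert (HFG : 4 * S * G < sqrt 3 * F).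
    { apply sqr_lt_reg.
      - apply Rmult_lt_0_compat; [apply sqrt_lt_R0; lra|assumption].
      - replace ((4 * S * G) ^ 2) with (16 * S ^ 2 * G ^ 2) by ring.
        replace ((sqrt 3 * F) ^ 2) with (sqrt 3 ^ 2 * F ^ 2) by ring.
        rewrite HS, pow2_sqrt by lra.
        apply Rlt_0_minus; unfold F, G; sym_poly_pos a b c H. }
    sides H.
    apply Rlt_le_trans with (a ^ 2 * (sqrt 3 * F - 4 * S * G)); [pos|right].
    unfold F, G, SA; ring.
Qed.

(** * Distances *)

Lemma pdist_sqr (P Q : point) :
  pdist P Q ^ 2 = (fst P - fst Q) ^ 2 + (snd P - snd Q) ^ 2.
Proof.
  unfold pdist; apply pow2_sqrt.
  apply Rplus_le_le_0_compat; apply pow2_ge_0.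
Qed.

Lemma cross_cyclic (A B C : point) : cross B C A = cross A B C.
Proof. unfold cross; ring. Qed.

Lemma side_a_pos (A B C : point) : cross A B C <> 0 -> 0 < side_a A B C.
Proof.
  intros HX; apply sqrt_lt_R0.
  pose proof (pow2_ge_0 (fst B - fst C)); pose proof (pow2_ge_0 (snd B - snd C)).
  destruct (Req_dec (fst B) (fst C)) as [E1|N1];
    [destruct (Req_dec (snd B) (snd C)) as [E2|N2]|].
  - exfalso; apply HX; unfold cross; rewrite E1, E2; ring.
  - pose proof (Rsqr_pos_lt (snd B - snd C) ltac:(lra)); unfold Rsqr in *; lra.
  - pose proof (Rsqr_pos_lt (fst B - fst C) ltac:(lra)); unfold Rsqr in *; lra.
Qed.

(** Law of cosines: [SA b c a] is twice [dot B C A], and [SA c a b] twice [dot C A B]. *)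
Lemma acute_min_side_of_triangle (A B C : point) :
  acute_triangle A B C ->
  side_a A B C < side_b A B C -> side_a A B C < side_c A B C ->
  acute_min_side (side_a A B C) (side_b A B C) (side_c A B C).
Proof.
  intros (HX & HA & HB & HC) Hb Hc.
  pose proof (side_a_pos A B C HX).
  repeat split; try assumption; unfold SA, side_a, side_b, side_c;
    rewrite !pdist_sqr; unfold dot in *; nra.
Qed.

(** The map sending [P] to [cross B C P] is affine and vanishes at [B] and [C], so at the center it
    is the share of [A] times [cross B C A]. The first factor on the right is the altitude from
    [A]. *)
Lemma d_BC_share (A B C : point) (f : center) :
  cross A B C <> 0 ->
  coord_sum f (side_a A B C) (side_b A B C) (side_c A B C) <> 0 ->
  d_BC A B C f =
  Rabs (cross B C A) / side_a A B C *
  share f (side_a A B C) (side_b A B C) (side_c A B C).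
Proof.
  intros HX Hs; pose proof (side_a_pos A B C HX) as Ha.
  rewrite <- cross_cyclic in HX; pose proof (Rabs_no_R0 _ HX) as Hr.
  pose proof (pow2_abs (cross B C A)) as Hsq.
  unfold d_BC, signed_dist_BC; change (pdist B C) with (side_a A B C).
  replace (cross B C (center_point f A B C)) with
    (share f (side_a A B C) (side_b A B C) (side_c A B C) * cross B C A).
  - set (X := cross B C A) in *.
    replace (share f (side_a A B C) (side_b A B C) (side_c A B C) * X * X)
      with (share f (side_a A B C) (side_b A B C) (side_c A B C) * Rabs X ^ 2)
      by (rewrite Hsq; ring).
    field; split; [lra|assumption].
  - unfold share, coord_sum in *; unfold center_point, cross; simpl.
    field; assumption.
Qed.

Lemma farther_d_BC (A B C : point) (f g : center) :
  cross A B C <> 0 ->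
  farther f g (side_a A B C) (side_b A B C) (side_c A B C) ->
  d_BC A B C f > d_BC A B C g.
Proof.
  intros HX (Hf & Hg & Hfg).
  rewrite !d_BC_share by assumption.
  apply Rmult_lt_compat_l; [|assumption].
  apply Rdiv_lt_0_compat.
  - apply Rabs_pos_lt; rewrite cross_cyclic; assumption.
  - apply side_a_pos; assumption.
Qed.

Theorem theorem5p1 (A B C : point) :
  acute_triangle A B C ->
  side_a A B C < side_b A B C ->
  side_a A B C < side_c A B C ->
  let d := d_BC A B C in
  d X26 > d X20 /\ d X20 > d X22 /\ d X22 > d X40 /\ d X40 > d X8 /\
  d X8 > d X9 /\ d X9 > d X10 /\ d X10 > d X2 /\ d X2 > d X37 /\
  d X37 > d X1 /\ d X1 > d X7 /\ d X7 > d X29 /\ d X29 > d X33 /\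
  d X33 > d X4 /\ d X4 > d X27 /\ d X27 > d X19 /\ d X19 > d X28 /\
  d X28 > d X25 /\ d X25 > d X34 /\ d X34 > d X24 /\ d X24 > d X36 /\
  d X36 > d X16.
Proof.
  intros Hacute Hb Hc d.
  pose proof (acute_min_side_of_triangle A B C Hacute Hb Hc) as H.
  destruct Hacute as (HX & _).
  repeat split; apply (farther_d_BC A B C _ _ HX).
  - apply farther_26_20; assumption.
  - apply farther_20_22; assumption.
  - apply farther_22_40; assumption.
  - apply farther_40_8; assumption.
  - apply farther_8_9; assumption.
  - apply farther_9_10; assumption.
  - apply farther_10_2; assumption.
  - apply farther_2_37; assumption.
  - apply farther_37_1; assumption.
  - apply farther_1_7; assumption.
  - apply farther_7_29; assumption.
  - apply farther_29_33; assumption.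
  - apply farther_33_4; assumption.
  - apply farther_4_27; assumption.
  - apply farther_27_19; assumption.
  - apply farther_19_28; assumption.
  - apply farther_28_25; assumption.
  - apply farther_25_34; assumption.
  - apply farther_34_24; assumption.
  - apply farther_24_36; assumption.
  - apply farther_36_16; assumption.
Qed.
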